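(* A quasi-isometry induces a homeomorphism of the spaces of $\alpha$-ends. That is, if $\alpha\ge 0$, $S$ is a subset of a pointed metric space $(X,x_0,d)$, and $\varphi:(X,x_0,d)\to(X',x_0',d')$ is a quasi-isometry to another pointed metric space, then, with $S'=\varphi(S)$, the space $\mathcal{E}^\alpha_\infty(S)$ of $\alpha$-ends of $S$ is homeomorphic to the space $\mathcal{E}^\alpha_\infty(S')$ of $\alpha$-ends of $S'$, via the map induced by $\varphi$ (which sends the $\alpha$-end represented by a quasi-ray $(x_n)$ to the $\alpha$-end represented by $(\varphi(x_n))$).
   Context: Quasi-isometries. A map $\varphi:X\to Y$ of metric spaces is a quasi-isometry if there are constants $C\ge1$, $A\ge0$ with $C^{-1}d(x,x')-A\le d(\varphi(x),\varphi(x'))\le C\,d(x,x')+A$ for all $x,x'\in X$, and every $y\in Y$ is within distance $A$ of $\varphi(X)$. A quasi-isometry $(X,x_0,d)\to(X',x_0',d')$ of pointed metric spaces is understood to send $x_0$ to $x_0'$. Closeness and connectedness. Let $(X,d)$ be a metric space with base point $x_0$, let $\alpha\ge 0$ and $K>0$ (with the convention $t^0=1$ for all $t\ge0$). Points $x,y\in X$ are $(\alpha,K)$-close if $d(x,y)\le K[\min\{d(x,x_0),d(y,x_0)\}]^\alpha+K$. For $S\subset X$, points $x,y\in S$ are $(\alpha,K)$-chained in $S$ if there are $x=x_1,x_2,\dots,x_n=y$ in $S$ ($n>1$) with $x_i,x_{i+1}$ $(\alpha,K)$-close for $1\le i\le n-1$. This is an equivalence relation on $S$; its classes are the $(\alpha,K)$-components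 of $S$. $S$ is $(\alpha,K)$-connected if it has just one $(\alpha,K)$-component. $B(x_0,R)$ is the open ball. Quasi-rays. The real $(\alpha,K)$-ray is the sequence $\mathbb{R}_{(\alpha,K)}=(a_n)_{n\ge0}\subset[0,\infty)$ with $a_0=0$ and $a_n=a_{n-1}+Ka_{n-1}^\alpha+K$ for $n>0$. An $(\alpha,K)$-quasi-ray in $S\subset X$ is an $(\alpha,K)$-connected sequence $(x_n)$ in $S$ that is the image of some real $(\alpha,K')$-ray ($K'>0$) under a quasi-isometry (onto the image, i.e. a quasi-isometric embedding of the real ray into $X$), and such that for every $R>0$ the set $(x_n)\setminus B(x_0,R)$ has exactly one unbounded $(\alpha,K)$-component. $(\alpha,K)$-ends. For two $(\alpha,K)$-quasi-rays in $S$, $(x_n)\sim(y_n)$ if for all $R>0$ the unbounded $(\alpha,K)$-component of $(x_n)\setminus B(x_0,R)$ and that of $(y_n)\setminus B(x_0,R)$ lie in the same $(\alpha,K)$-component of $S\setminus B(x_0,R)$. An $(\alpha,K)$-end of $S$ is an equivalence class of $(\alpha,K)$-quasi-rays in $S$; the set of these is $\mathcal{E}^\alpha_K=\mathcal{E}^\alpha_K(S)$. It is topologized by taking as basic open sets the following: for $R>0$ and an unbounded $(\alpha,K)$-component $U$ of $S\setminus B(x_0,R)$, the set of all $(\alpha,K)$-ends represented by $(x_n)$ such that the unbounded $(\alpha,K)$-component of $(x_n)\setminus B(x_0,R)$ lies in $U$. $\alpha$-ends. For $K<K'$ every $(\alpha,K)$-end is contained (as a set of quasi-rays) in a unique $(\alpha,K')$-end,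 giving a map $\mathcal{E}^\alpha_K\to\mathcal{E}^\alpha_{K'}$. On the disjoint union $\bigsqcup_{K>0}\mathcal{E}^\alpha_K$ put $E\sim E'$ (for $E\in\mathcal{E}^\alpha_K$, $E'\in\mathcal{E}^\alpha_{K'}$) if there are $L\ge K,K'$ and $F\in\mathcal{E}^\alpha_L$ such that $E$ and $E'$ are contained in $F$. The space of $\alpha$-ends of $S$ is $\mathcal{E}^\alpha_\infty(S)=\bigsqcup_{K>0}\mathcal{E}^\alpha_K/\!\sim$ with the direct limit topology: a set of $\alpha$-ends is open iff for each $K$ its preimage in $\mathcal{E}^\alpha_K$ is open. *)

(* Defs.v *)
From HB Require Import structures.
From mathcomp Require Import all_boot all_order all_algebra.
From mathcomp Require Import all_classical all_reals all_analysis.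

Set Implicit Arguments.
Unset Strict Implicit.
Unset Printing Implicit Defensive.

Import Order.TTheory GRing.Theory Num.Theory.
Import numFieldNormedType.Exports.

Local Open Scope classical_set_scope.
Local Open Scope ring_scope.
Local Open Scope quotient_scope.

(* Quasi-isometry between the subspaces A of X and B of Y. *)
Definition quasi_isometry_on (R : realType) (X Y : metricType R)
    (A : set X) (B : set Y) (f : X -> Y) : Prop :=
  f @` A `<=` B /\
  exists C a : R, [/\ 1 <= C, 0 <= a,
    forall x x', A x -> A x' ->
      C^-1 * mdist x x' - a <= mdist (f x) (f x') <= C * mdist x x' + a &
    forall y, B y -> exists2 x, A x & mdist y (f x) <= a].

Definition quasi_isometry (R : realType) (X Y : metricType R) (f : X -> Y) :=
  quasi_isometry_on [set: X] [set: Y] f.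

Definition homeomorphism (T U : topologicalType) (h : T -> U) : Prop :=
  exists g : U -> T, [/\ cancel h g, cancel g h, continuous h & continuous g].

(* [powR] satisfies t `^ 0 = 1 for all t, including t = 0, and for a > 0 it
   satisfies 0 `^ a = 0. *)
Fixpoint real_ray (R : realType) (alpha : {nonneg R}) (K : R) (n : nat) : R :=
  if n is m.+1 then
    real_ray alpha K m + K * real_ray alpha K m `^ alpha%:num + K
  else 0.

Section close.
Context {R : realType} {X : metricType R}.
Variables (x0 : X) (alpha : {nonneg R}).
Implicit Types (K r : R) (S T U V W : set X) (x y : X).

Definition ak_close K x y : Prop :=
  mdist x y <= K * Num.min (mdist x x0) (mdist y x0) `^ alpha%:num + K.

(* The chain x = z 0, ..., z n = y has n + 1 points, at least two. *)
Definition ak_chained K S x y : Prop :=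
  exists (n : nat) (z : nat -> X),
    [/\ (0 < n)%N, z 0 = x, z n = y,
        forall i, (i <= n)%N -> S (z i) &
        forall i, (i < n)%N -> ak_close K (z i) (z i.+1)].

Definition ak_component K S : set (set X) :=
  [set U | exists2 x, S x & U = [set y | ak_chained K S x y]].

Definition ak_connected K S : Prop := exists! U, ak_component K S U.

Definition unbounded U : Prop := ~ exists r : R, U `<=` ball x0 r.

Definition unbounded_component K S : set (set X) :=
  [set U | ak_component K S U /\ unbounded U].

Definition quasi_ray K S (x : nat -> X) : Prop :=
  [/\ forall n, S (x n),
      ak_connected K (range x),
      exists (K' : R) (f : R^o -> X), [/\ 0 < K',
        @quasi_isometry_on R R^o X (range (real_ray alpha K')) (range x) f &
        forall n, x n = f (real_ray alpha K' n)] &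
      forall r, 0 < r ->
        exists! U, unbounded_component K (range x `\` ball x0 r) U].

(* For quasi-rays the sets U and V below exist and are unique. *)
Definition ray_equiv K S (x y : nat -> X) : Prop :=
  forall r, 0 < r -> forall U V,
    unbounded_component K (range x `\` ball x0 r) U ->
    unbounded_component K (range y `\` ball x0 r) V ->
    exists W, [/\ ak_component K (S `\` ball x0 r) W, U `<=` W & V `<=` W].

Definition ray_class K S (x : nat -> X) : set (nat -> X) :=
  [set y | quasi_ray K S y /\ ray_equiv K S x y].

Definition is_ak_end K S : set (set (nat -> X)) :=
  [set E | exists2 x, quasi_ray K S x & E = ray_class K S x].

Lemma ak_close_sym K x y : ak_close K x y -> ak_close K y x.
Proof. by rewrite /ak_close metric_sym minC. Qed.

Lemma ak_close_refl K x : 0 < K -> ak_close K x x.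
Proof.
by move=> K0; rewrite /ak_close mdistxx addr_ge0 ?mulr_ge0 ?powR_ge0// ltW.
Qed.

Lemma ak_close_le K L x y : K <= L -> ak_close K x y -> ak_close L x y.
Proof.
move=> KL /le_trans; apply; apply: lerD => //.
by apply: ler_wpM2r => //; exact: powR_ge0.
Qed.

Lemma ak_chained_refl K S x : 0 < K -> S x -> ak_chained K S x x.
Proof.
move=> K0 Sx; exists 1, (fun=> x); split => // i _; exact: ak_close_refl.
Qed.

Lemma ak_chained_sym K S x y : ak_chained K S x y -> ak_chained K S y x.
Proof.
move=> [n [z [n0 zx zy zS zc]]]; exists n, (fun i => z (n - i)%N); split => //.
- by rewrite subn0.
- by rewrite subnn.
- by move=> i _; apply: zS; exact: leq_subr.
- move=> i iltn; apply: ak_close_sym.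
  have -> : (n - i = (n - i.+1).+1)%N by rewrite subnSK.
  by apply: zc; rewrite -subSn// subSS leq_subr.
Qed.

Lemma ak_chained_trans K S x y w :
  ak_chained K S x y -> ak_chained K S y w -> ak_chained K S x w.
Proof.
move=> [n [z [n0 zx zy zS zc]]] [m [t [m0 ty tw tS tc]]].
exists (n + m)%N, (fun i => if (i <= n)%N then z i else t (i - n)%N); split.
- by rewrite addn_gt0 n0.
- by rewrite leq0n.
- have [|_] := leqP (n + m)%N n; last by rewrite addKn.
  by rewrite -{2}(addn0 n) leq_add2l leqn0 => /eqP m00; rewrite m00 in m0.
- move=> i inm; have [|ni] := leqP i n; first exact: zS.
  by apply: tS; rewrite leq_subLR.
- move=> i inm; case: (ltngtP i n) => [ilt|ni|->].
  + exact: zc.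
  + by rewrite subSn ?(ltnW ni)//; apply: tc; rewrite ltn_subLR// ltnW.
  + by rewrite subSn// subnn zy -ty; exact: tc.
Qed.

Lemma ak_chained_sub K L S T x y : K <= L -> S `<=` T ->
  ak_chained K S x y -> ak_chained L T x y.
Proof.
move=> KL ST [n [z [n0 zx zy zS zc]]]; exists n, z; split => // i lin.
  by apply: ST; exact: zS.
by apply: ak_close_le KL _; exact: zc.
Qed.

Lemma ak_chained_mem K S x y : ak_chained K S x y -> S x /\ S y.
Proof.
by move=> [n [z [_ <- <- zS _]]]; split; apply: zS; rewrite ?leqnn.
Qed.

Lemma ak_componentE K S U x : ak_component K S U -> U x ->
  U = [set y | ak_chained K S x y].
Proof.
move=> [u Su ->] /= ux; apply/seteqP; split => y /=.
  by apply: ak_chained_trans; exact: ak_chained_sym.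
exact: ak_chained_trans ux.
Qed.

Lemma ak_component_in K S x : S x ->
  ak_component K S [set y | ak_chained K S x y].
Proof. by exists x. Qed.

Lemma ak_component_subset K S U : ak_component K S U -> U `<=` S.
Proof. by move=> [x Sx ->] y /= xy; have [] := ak_chained_mem xy. Qed.

Lemma ak_component_eq K S U V x :
  ak_component K S U -> ak_component K S V -> U x -> V x -> U = V.
Proof. by move=> /ak_componentE cU /ak_componentE cV /cU -> /cV ->. Qed.

Lemma unbounded_mono U V : U `<=` V -> unbounded U -> unbounded V.
Proof. by move=> UV nU [r Vr]; apply: nU; exists r => x /UV/Vr. Qed.

Lemma unbounded_nonempty U : unbounded U -> U !=set0.
Proof.
by move=> nU; apply/set0P/eqP => U0; apply: nU; exists 0; rewrite U0.
Qed.

(* A component over a smaller set, for a smaller constant, is contained in a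
   component over a larger one. *)
Lemma ak_component_sub K L S T U : 0 < K -> K <= L -> S `<=` T ->
  ak_component K S U -> exists2 W, ak_component L T W & U `<=` W.
Proof.
move=> K0 KL ST [x Sx ->]; exists [set y | ak_chained L T x y].
  by exists x => //; exact: ST.
by move=> y /=; exact: ak_chained_sub.
Qed.

Lemma real_ray_ge0 K n : 0 < K -> 0 <= real_ray alpha K n.
Proof.
move=> K0; elim: n => //= n IH.
by rewrite !addr_ge0 ?mulr_ge0 ?powR_ge0// ltW.
Qed.

Lemma real_ray_ge K n : 0 < K -> n%:R * K <= real_ray alpha K n.
Proof.
move=> K0; elim: n => /= [|n IH]; first by rewrite mul0r.
rewrite -natr1 mulrDl mul1r lerD2r (le_trans IH)// lerDl.
by rewrite mulr_ge0 ?powR_ge0// ltW.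
Qed.

Lemma quasi_ray_proper K S (x : nat -> X) : quasi_ray K S x ->
  forall M : R, exists N, forall n, (N <= n)%N -> M <= mdist (x n) x0.
Proof.
move=> [_ _ [K' [f [K'0 [_ [C [a [C1 a0 fqi _]]]] xE]]] _] M.
have C0 : 0 < C by rewrite (lt_le_trans _ C1).
pose B := C * (M + a + mdist (x 0%N) x0).
have [N /ltW NB] : exists N : nat, B / K' < N%:R.
  exists (Num.trunc `|B / K'|).+1; apply: (le_lt_trans (ler_norm _)).
  by have /andP[] := truncn_itv (normr_ge0 (B / K')).
exists N => n Nn.
have ray_n : B <= real_ray alpha K' n.
  rewrite (le_trans _ (real_ray_ge n K'0))// -ler_pdivrMr// (le_trans NB)//.
  by rewrite ler_nat.
have /andP[+ _] := fqi (real_ray alpha K' n) (real_ray alpha K' 0)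
  ltac:(by exists n) ltac:(by exists 0%N).
rewrite -!xE /mdist /= sub0r normrN ger0_norm ?real_ray_ge0// => dn.
have : M + a + mdist (x 0%N) x0 <= C^-1 * real_ray alpha K' n.
  by rewrite ler_pdivlMl.
have := metric_triangle (x n) x0 (x 0%N).
rewrite (metric_sym x0 (x 0%N)) => tri Mn.
rewrite -(lerD2r (mdist (x 0%N) x0)) (le_trans _ tri)// (le_trans _ dn)//.
by rewrite -(lerD2r a) subrK addrAC.
Qed.

Lemma ak_connected_chained K S x y : ak_connected K S -> S x -> S y ->
  0 < K -> ak_chained K S x y.
Proof.
move=> [U [_ Uuniq]] Sx Sy K0.
have Ex := Uuniq _ (ak_component_in K Sx).
have Ey := Uuniq _ (ak_component_in K Sy).
have : [set w | ak_chained K S y w] y by exact: ak_chained_refl.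
by rewrite -Ey Ex.
Qed.

(* The unbounded component of a quasi-ray outside a ball contains all but
   finitely many terms: a chain leaving another component enters the ball, so
   that component meets the bounded set of points close to the ball. *)
Lemma quasi_ray_tail K S (x : nat -> X) r U :
  0 < K -> 0 < r -> quasi_ray K S x ->
  unbounded_component K (range x `\` ball x0 r) U ->
  exists N, forall n, (N <= n)%N -> U (x n).
Proof.
move=> K0 r0 qx [cU uU]; have xproper := quasi_ray_proper qx.
have [_ xconn _ /(_ _ r0)[U' [_ Uuniq]]] := qx.
have {U' Uuniq} Uuniq V :
    unbounded_component K (range x `\` ball x0 r) V -> V = U.
  by move=> uV; rewrite -(Uuniq _ uV); apply: Uuniq; split.
pose T := range x `\` ball x0 r.
have [u Uu] := unbounded_nonempty uU.
have [N1 N1P] := xproper (r + (K * r `^ alpha%:num + K) + 1).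
have near_ball n : T (x n) -> ~ U (x n) ->
    exists2 m, (m < N1)%N & ak_chained K T (x n) (x m).
  move=> Tn nUn.
  have [k [z [k0 zn zu zS zc]]] : ak_chained K (range x) (x n) u.
    apply: ak_connected_chained => //.
    by have [] := ak_component_subset cU Uu.
  have nku : ~ ak_chained K T (x n) (z k).
    rewrite zu => nu; apply: nUn.
    by rewrite (ak_componentE cU Uu); exact: ak_chained_sym.
  have [i [ik ci nci]] : exists i, [/\ (i < k)%N, ak_chained K T (x n) (z i) &
      ~ ak_chained K T (x n) (z i.+1)].
    apply: contrapT => noi.
    suff h : forall i, (i <= k)%N -> ak_chained K T (x n) (z i).
      exact: nku (h k (leqnn k)).
    elim=> [_|i IH ik]; first by rewrite zn; exact: ak_chained_refl.
    apply: contrapT => nci; apply: noi; exists i; split => //.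
    exact/IH/ltnW.
  have [m _ mE] := zS i (ltnW ik).
  exists m; last by rewrite mE.
  rewrite ltnNge; apply/negP => /N1P; apply/negP; rewrite -ltNge mE.
  have zi1r : mdist (z i.+1) x0 < r.
    rewrite metric_sym; apply: contrapT => /negP; rewrite -leNgt => rz.
    apply: nci; apply: (ak_chained_trans ci).
    have Tz : T (z i.+1).
      split; first exact: zS.
      by rewrite ballEmdist/= => /lt_geF; rewrite rz.
    exists 1%N, (fun j => if j is 0%N then z i else z i.+1); split => //.
    - move=> [|j] //= _; by have [] := ak_chained_mem ci.
    - by move=> [|j] //= _; exact: zc.
  have := zc _ ik; rewrite /ak_close => dz.
  have tri := metric_triangle (z i) (z i.+1) x0.
  rewrite (le_lt_trans tri)// addrC.
  have : mdist (z i) (z i.+1) <= K * r `^ alpha%:num + K.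
    apply: (le_trans dz); rewrite lerD2r ler_pM2l//.
    apply: ge0_ler_powR; rewrite ?nnegrE ?ge_min ?le_min ?mdist_ge0 ?(ltW r0)//.
    by rewrite (ltW zi1r) orbT.
  move=> dz'; rewrite -addrA; apply: ltr_leD => //.
  by rewrite (le_trans dz')// lerDl.
have [B BP] : exists B : R, forall m, (m < N1)%N -> forall n,
    T (x n) -> ~ U (x n) -> ak_chained K T (x n) (x m) -> mdist (x n) x0 < B.
  elim: N1 {N1P near_ball} => [|N1 [B BP]]; first by exists 0.
  have [[n0 [Tn0 nUn0 cn0]]|none] := pselect (exists n0,
      [/\ T (x n0), ~ U (x n0) & ak_chained K T (x n0) (x N1)]); last first.
    exists B => m; rewrite ltnS leq_eqVlt => /orP[/eqP-> n Tn nUn cn|/BP//].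
    by exfalso; apply: none; exists n.
  have [b bP] : exists b, [set y | ak_chained K T (x n0) y] `<=` ball x0 b.
    apply: contrapT => ub; apply: nUn0.
    have /Uuniq <- : unbounded_component K T [set y | ak_chained K T (x n0) y].
      by split => //; exact: ak_component_in.
    exact: ak_chained_refl.
  exists (Num.max B b) => m; rewrite ltnS leq_eqVlt.
  move=> /orP[/eqP-> n Tn nUn cn|].
    rewrite lt_max; apply/orP; right.
    suff : ball x0 b (x n) by rewrite ballEmdist/= metric_sym.
    by apply: bP => /=; apply: (ak_chained_trans cn0); exact: ak_chained_sym.
  by move=> mN n Tn nUn cn; rewrite lt_max (BP m mN n).
have [N2 N2P] := xproper (Num.max r B).
exists N2 => n /N2P; rewrite ge_max => /andP[rn Bn].
have Tn : T (x n).
  by split; [exists n|rewrite ballEmdist/= metric_sym => /lt_geF; rewrite rn].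
apply: contrapT => nUn; have [m mN1 cm] := near_ball n Tn nUn.
by have := BP m mN1 n Tn nUn cm; rewrite ltNge Bn.
Qed.

Lemma unbounded_frequently (x : nat -> X) V N : unbounded V -> V `<=` range x ->
  exists2 n, (N <= n)%N & V (x n).
Proof.
move=> uV Vx; apply: contrapT => noV; apply: uV.
suff [r rP] : exists r, forall n, (n < N)%N -> mdist x0 (x n) < r.
  exists r => v Vv; have [n _ nv] := Vx _ Vv.
  rewrite ballEmdist/= -nv; apply: rP; rewrite ltnNge; apply/negP => Nn.
  by apply: noV; exists n => //; rewrite nv.
elim: N {noV} => [|N [r rP]]; first by exists 0.
exists (Num.max r (mdist x0 (x N) + 1)) => n; rewrite ltnS leq_eqVlt lt_max.
by move=> /orP[/eqP->|/rP->//]; rewrite ltrDl ltr01 orbT.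
Qed.

Lemma quasi_ray_le K L S (x : nat -> X) : 0 < K -> K <= L ->
  quasi_ray K S x -> quasi_ray L S x.
Proof.
move=> K0 KL qx; have L0 := lt_le_trans K0 KL.
have [xS xc xqi xu] := qx; split => //.
  exists (range x); split.
    exists (x 0%N); first by exists 0%N.
    apply/seteqP; split => y; last by move=> /= h; have [] := ak_chained_mem h.
    move=> yx; apply: (@ak_chained_sub K L (range x)) => //.
    by apply: ak_connected_chained => //; exists 0%N.
  move=> _ [u ux ->]; apply/seteqP; split => y /=.
    move=> yx; apply: (@ak_chained_sub K L (range x)) => //.
    exact: ak_connected_chained.
  by move=> h; have [] := ak_chained_mem h.
move=> r r0; have [U [uU _]] := xu _ r0; have [cU nU] := uU.
have [W cW UW] := @ak_component_sub K L _ _ _ K0 KL (@subset_refl _ _) cU.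
exists W; split; first by split => //; exact: unbounded_mono nU.
move=> V [cV nV]; have [N NP] := quasi_ray_tail K0 r0 qx uU.
have [|n Nn Vn] := @unbounded_frequently x V N nV.
  by move=> v /(ak_component_subset cV)[].
exact: ak_component_eq cW cV (UW _ (NP _ Nn)) Vn.
Qed.

Lemma ray_equiv_refl K S (x : nat -> X) :
  0 < K -> quasi_ray K S x -> ray_equiv K S x x.
Proof.
move=> K0 [xS _ _ xu] r r0 U V uU uV.
have [U' [_ Uuniq]] := xu _ r0; rewrite -(Uuniq _ uU) -(Uuniq _ uV).
have [cU _] := uU; rewrite (Uuniq _ uU).
have [||W cW UW] := @ak_component_sub K K _ (S `\` ball x0 r) _ K0 _ _ cU => //.
  by move=> _ [[n _ <-] nb]; split.
by exists W.
Qed.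

Lemma ray_equiv_sym K S (x y : nat -> X) :
  ray_equiv K S x y -> ray_equiv K S y x.
Proof.
move=> xy r r0 U V uU uV; have [W [cW VW UW]] := xy _ r0 _ _ uV uU.
by exists W.
Qed.

Lemma ray_equiv_trans K S (x y z : nat -> X) : quasi_ray K S y ->
  ray_equiv K S x y -> ray_equiv K S y z -> ray_equiv K S x z.
Proof.
move=> [_ _ _ yu] xy yz r r0 U V uU uV; have [T [uT _]] := yu _ r0.
have [W [cW UW TW]] := xy _ r0 _ _ uU uT.
have [W' [cW' TW' VW']] := yz _ r0 _ _ uT uV.
have [t Tt] := unbounded_nonempty uT.2.
have WW' := ak_component_eq cW cW' (TW _ Tt) (TW' _ Tt).
by exists W; split => //; rewrite WW'.
Qed.

Lemma is_ak_endE K S E (x : nat -> X) :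
  is_ak_end K S E -> E x -> E = ray_class K S x.
Proof.
move=> [u qu ->] [qx ux]; apply/seteqP; split => y [qy ?]; split => //.
  by apply: (ray_equiv_trans qu) => //; exact: ray_equiv_sym.
exact: ray_equiv_trans ux _.
Qed.

Lemma is_ak_end_quasi_ray K S E (x : nat -> X) :
  is_ak_end K S E -> E x -> quasi_ray K S x.
Proof. by move=> [u _ ->] []. Qed.

Lemma is_ak_end_nonempty K S E : 0 < K -> is_ak_end K S E -> E !=set0.
Proof.
by move=> K0 [u qu ->]; exists u; split => //; exact: ray_equiv_refl.
Qed.

(* Every end for K is contained in an end for any larger constant; by
   [is_ak_endE] the latter is unique. *)
Lemma is_ak_end_le K L S E : 0 < K -> K <= L -> is_ak_end K S E ->
  exists2 F, is_ak_end L S F & E `<=` F.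
Proof.
move=> K0 KL [x qx ->]; exists (ray_class L S x).
  by exists x => //; exact: quasi_ray_le KL _.
move=> y [qy xy]; split; first exact: quasi_ray_le KL _.
move=> r r0 U V uU uV.
have sub (z : nat -> X) (Z : set X) : quasi_ray K S z ->
    unbounded_component L (range z `\` ball x0 r) Z ->
    exists2 Z', unbounded_component K (range z `\` ball x0 r) Z' & Z' `<=` Z.
  move=> qz uZ; have [_ _ _ zK] := qz.
  have [_ _ _ /(_ _ r0)[Y [_ Yu]]] := quasi_ray_le K0 KL qz.
  have [Z' [uZ' _]] := zK _ r0; exists Z' => //.
  have [W cW ZW] := @ak_component_sub K L _ _ _ K0 KL (@subset_refl _ _) uZ'.1.
  suff -> : Z = W by [].
  rewrite -(Yu _ uZ); apply: Yu; split => //.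
  exact: unbounded_mono uZ'.2.
have [U' uU' UU] := sub _ _ qx uU; have [V' uV' VV] := sub _ _ qy uV.
have [W [cW UW VW]] := xy _ r0 _ _ uU' uV'.
have [W' cW' WW'] := @ak_component_sub K L _ _ _ K0 KL (@subset_refl _ _) cW.
exists W'; split => // w.
- have [u Uu] := unbounded_nonempty uU'.2.
  rewrite (ak_componentE uU.1 (UU _ Uu)) (ak_componentE cW' (WW' _ (UW _ Uu))).
  apply: ak_chained_sub => //; have [xS _ _ _] := qx.
  by move=> _ [[n _ <-] nb]; split.
- have [u Uu] := unbounded_nonempty uV'.2.
  rewrite (ak_componentE uV.1 (VV _ Uu)) (ak_componentE cW' (WW' _ (VW _ Uu))).
  apply: ak_chained_sub => //; have [yS _ _ _] := qy.
  by move=> _ [[n _ <-] nb]; split.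
Qed.

End close.

Section ends.
Context {R : realType} {X : metricType R}.
Variables (x0 : X) (alpha : {nonneg R}) (S : set X).

Definition ak_ends (K : {posnum R}) : Type :=
  {E : set (nat -> X) | E \in is_ak_end x0 alpha K%:num S}.

HB.instance Definition _ K := SubChoice.on (ak_ends K).

Lemma ak_endsP K (E : ak_ends K) : is_ak_end x0 alpha K%:num S (val E).
Proof. by have := valP E; rewrite inE. Qed.

(* The indices (r, U) of the basic open sets of [ak_ends K]. *)
Definition ak_ends_base_index (K : {posnum R}) : set (R * set X) :=
  [set i | 0 < i.1 /\
    unbounded_component x0 alpha K%:num (S `\` ball x0 i.1) i.2].

Definition ak_ends_base (K : {posnum R}) (i : R * set X) : set (ak_ends K) :=
  [set E | exists2 x, val E x & exists2 V,
    unbounded_component x0 alpha K%:num (range x `\` ball x0 i.1) V &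
    V `<=` i.2].

Lemma ak_ends_base_cover K :
  \bigcup_(i in ak_ends_base_index K) @ak_ends_base K i = setT.
Proof.
apply/seteqP; split => // E _; have PE := ak_endsP E.
have [x Ex] := is_ak_end_nonempty (gt0 K) PE.
have [xS _ _ /(_ 1 ltr01)[V [uV _]]] := is_ak_end_quasi_ray PE Ex.
have [||W cW VW] := @ak_component_sub _ _ x0 alpha _ K%:num _
  (S `\` ball x0 1) _ (gt0 K) _ _ uV.1 => //.
  by move=> _ [[n _ <-] nb]; split.
exists (1, W); last by exists x => //; exists V.
by split => //; split => //; exact: unbounded_mono uV.2.
Qed.

Lemma ak_ends_base_join K i j E :
  ak_ends_base_index K i -> ak_ends_base_index K j ->
  @ak_ends_base K i E -> @ak_ends_base K j E ->
  exists k, [/\ ak_ends_base_index K k, @ak_ends_base K k E &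
    @ak_ends_base K k `<=` @ak_ends_base K i `&` @ak_ends_base K j].
Proof.
have K0 : 0 < K%:num by [].
(* any representative may be used to test membership in a basic set *)
have repr k F x : ak_ends_base_index K k -> val F x -> @ak_ends_base K k F ->
    exists2 V, unbounded_component x0 alpha K%:num (range x `\` ball x0 k.1) V &
      V `<=` k.2.
  move=> [k0 [ck _]] Fx [y Fy [V uV Vk]]; have PF := ak_endsP F.
  have [_ _ _ /(_ _ k0)[V' [uV' _]]] := is_ak_end_quasi_ray PF Fx.
  exists V' => //; move: Fy; rewrite (is_ak_endE PF Fx) => -[qy xy].
  have [W [cW VW V'W]] := xy _ k0 _ _ uV' uV.
  have [v Vv] := unbounded_nonempty uV.2.
  by rewrite (ak_component_eq ck cW (Vk _ Vv) (V'W _ Vv)).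
have mono k l F G : ak_ends_base_index K k -> ak_ends_base_index K l ->
    k.1 <= l.1 -> @ak_ends_base K k F -> @ak_ends_base K l F ->
    @ak_ends_base K l G -> @ak_ends_base K k G.
  move=> Ik Il kl kF lF [y Gy [W uW Wl]].
  have sub (A : set X) : A `\` ball x0 l.1 `<=` A `\` ball x0 k.1.
    by move=> p [Ap nb]; split => //; apply: contra_not nb; exact: le_ball.
  have [x Fx] := is_ak_end_nonempty K0 (ak_endsP F).
  have [V uV Vk] := repr _ _ _ Ik Fx kF; have [T uT Tl] := repr _ _ _ Il Fx lF.
  have tail z (Z Z' : set X) : quasi_ray x0 alpha K%:num S z ->
      unbounded_component x0 alpha K%:num (range z `\` ball x0 l.1) Z ->
      unbounded_component x0 alpha K%:num (range z `\` ball x0 k.1) Z' ->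
      Z `<=` Z'.
    move=> [_ _ _ /(_ _ Ik.1)[Y [_ Yu]]] uZ uZ'.
    have [Z2 cZ2 ZZ2] :=
      ak_component_sub K0 (lexx _) (sub (range z)) uZ.1.
    suff -> : Z' = Z2 by [].
    by rewrite -(Yu _ uZ'); apply: Yu; split => //; exact: unbounded_mono uZ.2.
  have qx := is_ak_end_quasi_ray (ak_endsP F) Fx.
  have qy := is_ak_end_quasi_ray (ak_endsP G) Gy.
  have [_ _ _ /(_ _ Ik.1)[W' [uW' _]]] := qy.
  have [t Tt] := unbounded_nonempty uT.2.
  have [w Ww] := unbounded_nonempty uW.2.
  have [L cL lL] := ak_component_sub K0 (lexx _) (sub S) Il.2.1.
  have kL : k.2 = L.
    apply: (ak_component_eq Ik.2.1 cL _ (lL _ (Tl _ Tt))).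
    by apply: Vk; exact: tail uT uV _ Tt.
  exists y => //; exists W' => // p W'p.
  have W'w := tail _ _ _ qy uW uW' _ Ww.
  move: W'p; rewrite (ak_componentE uW'.1 W'w) kL.
  rewrite (ak_componentE cL (lL _ (Wl _ Ww))).
  apply: ak_chained_sub => //; have [yS _ _ _] := qy.
  by move=> _ [[n _ <-] nb]; split.
move=> Ii Ij iE jE; have [ij|/ltW ji] := leP i.1 j.1.
  by exists j; split => // G jG; split => //; exact: mono iE jE _.
by exists i; split => // G iG; split => //; exact: mono jE iE _.
Qed.

HB.instance Definition _ K := @isBaseTopological.Build (ak_ends K)
  (R * set X)%type (ak_ends_base_index K) (@ak_ends_base K)
  (@ak_ends_base_cover K) (@ak_ends_base_join K).

(* The disjoint union of the spaces [ak_ends K], over all K > 0. *)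
Definition ak_ends_union : Type := {K : {posnum R} & ak_ends K}.

HB.instance Definition _ := Topological.on ak_ends_union.

Definition same_alpha_end (E E' : ak_ends_union) : Prop :=
  exists (L : {posnum R}) (F : ak_ends L),
    [/\ (projT1 E)%:num <= L%:num, (projT1 E')%:num <= L%:num,
        val (projT2 E) `<=` val F & val (projT2 E') `<=` val F].

Let same E E' := `[< same_alpha_end E E' >].

Lemma same_alpha_end_refl : reflexive same.
Proof. by move=> [K E]; apply/asboolP; exists K, E; split. Qed.

Lemma same_alpha_end_sym : symmetric same.
Proof.
have sym E E' : same_alpha_end E E' -> same_alpha_end E' E.
  by move=> [L [F [? ? ? ?]]]; exists L, F; split.
by move=> E E'; apply: asbool_equiv_eq; split => /sym.
Qed.

Lemma same_alpha_end_trans : transitive same.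
Proof.
move=> E2 E1 E3 /asboolP[L [F [L1 L2 F1 F2]]].
move=> /asboolP[L' [F' [L2' L3' F2' F3']]].
apply/asboolP.
have [M [LM L'M]] : exists M : {posnum R},
    L%:num <= M%:num /\ L'%:num <= M%:num.
  exists (PosNum (addr_gt0 (gt0 L) (gt0 L'))) => /=.
  by rewrite lerDl lerDr.
have [G PG FG] := is_ak_end_le (gt0 L) LM (ak_endsP F).
have [G' PG' FG'] := is_ak_end_le (gt0 L') L'M (ak_endsP F').
have [x xE2] := is_ak_end_nonempty (gt0 _) (ak_endsP (projT2 E2)).
have GG' : G' = G.
  rewrite (is_ak_endE PG (FG _ (F2 _ xE2))).
  by rewrite (is_ak_endE PG' (FG' _ (F2' _ xE2))).
exists M, (exist _ G (mem_set PG) : ak_ends M); split => /=.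
- exact: le_trans LM.
- exact: le_trans L'M.
- exact: subset_trans FG.
- by rewrite -GG'; exact: subset_trans FG'.
Qed.

Definition same_alpha_end_rel : equiv_rel ak_ends_union :=
  EquivRel same same_alpha_end_refl same_alpha_end_sym same_alpha_end_trans.

Definition alpha_ends : Type := quotient_topology {eq_quot same_alpha_end_rel}.

HB.instance Definition _ := Topological.on alpha_ends.
HB.instance Definition _ := Quotient.on alpha_ends.

Definition represents_alpha_end (x : nat -> X) (e : alpha_ends) : Prop :=
  exists (K : {posnum R}) (E : ak_ends K),
    val E x /\ e = \pi_alpha_ends (existT ak_ends K E).

(* The topology of [alpha_ends] is the direct limit topology. *)
Lemma open_alpha_endsP (U : set alpha_ends) :
  open U <-> forall K : {posnum R},
    open [set E : ak_ends K | U (\pi_alpha_ends (existT ak_ends K E))].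
Proof. exact: sigT_openP. Qed.

End ends.

(* Main.v *)
Require Import Defs.
From mathcomp Require Import all_boot all_order all_algebra.
From mathcomp Require Import all_classical all_reals all_analysis.
From mathcomp Require Import lra.

(* Two quasi-rays are equivalent iff, outside any ball, their tails are
   chained to each other.  A map [f] that is a quasi-isometric embedding and
   distorts distances to the base points in the same controlled way sends
   (alpha, K)-close points to (alpha, K1)-close points, with K1 depending only
   on K and [f], hence it sends chains outside large balls to chains outside
   balls, and it induces a continuous map of alpha-ends.  A section of [phi]
   over [phi @` S] is again such a map, and it is an inverse of [phi] up to a
   bounded error, which is absorbed by enlarging K. *)

Set Implicit Arguments.
Unset Strict Implicit.
Unset Printing Implicit Defensive.

Import Order.TTheory GRing.Theory Num.Theory.

Local Open Scope classical_set_scope.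
Local Open Scope ring_scope.
Local Open Scope quotient_scope.

(** The base is at most [C + a] when [t <= 1], and at most [(C + a) * t] otherwise. This lets the
    term [t ^ alpha] in closeness survive an affine change of distances. *)
Lemma powR_affine_le (R : realType) (p C a t : R) : 0 <= p -> 0 <= C -> 0 <= a ->
  0 <= t -> (C * t + a) `^ p <= (C + a) `^ p * (t `^ p + 1).
Proof.
move=> p0 C0 a0 t0; have Ca0 : 0 <= C + a by exact: addr_ge0.
have Cta0 : 0 <= C * t + a by rewrite addr_ge0 ?mulr_ge0.
have [t1|/ltW t1] := leP t 1.
  apply: (@le_trans _ _ ((C + a) `^ p)).
    by apply: ge0_ler_powR; rewrite ?nnegrE// lerD2r ler_piMr.
  by rewrite ler_peMr ?powR_ge0// lerDr powR_ge0.
apply: (@le_trans _ _ ((C + a) `^ p * t `^ p)).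
  rewrite -powRM//; apply: ge0_ler_powR; rewrite ?nnegrE ?mulr_ge0//.
  by rewrite mulrDl lerD2l ler_peMr.
by rewrite ler_wpM2l ?powR_ge0// lerDl.
Qed.

(** * Quasi-rays through their tails *)

Section tails.
Context {R : realType} {X : metricType R}.
Variables (x0 : X) (alpha : {nonneg R}).
Implicit Types (K L r : R) (S T U V W : set X) (x y z : nat -> X).

(** Replaces unbounded components by indices. With [x = y] and [S = range x] it encodes that a
    proper sequence has a single unbounded component outside each ball. *)
Definition tail_chained K S x y : Prop :=
  forall r, 0 < r -> exists N : nat, forall n m, (N <= n)%N -> (N <= m)%N ->
    ak_chained x0 alpha K (S `\` ball x0 r) (x n) (y m).

Lemma notin_ball (p : X) r : r <= mdist p x0 <-> ~ ball x0 r p.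
Proof.
rewrite ballEmdist/= metric_sym leNgt.
by split => [/negP//|?]; apply/negP.
Qed.

Lemma tail_chained_sub K L S T x y : K <= L -> S `<=` T ->
  tail_chained K S x y -> tail_chained L T x y.
Proof.
move=> KL ST xy r r0; have [N NP] := xy r r0; exists N => n m Nn Nm.
apply: ak_chained_sub KL _ (NP _ _ Nn Nm).
by move=> p [Sp nb]; split => //; exact: ST.
Qed.

Lemma quasi_ray_tail_chained K S x : 0 < K -> quasi_ray x0 alpha K S x ->
  tail_chained K (range x) x x.
Proof.
move=> K0 qx r r0; have [_ _ _ /(_ r r0)[U [uU _]]] := qx.
have [N NP] := quasi_ray_tail K0 r0 qx uU; exists N => n m Nn Nm.
by have := NP _ Nm; rewrite (ak_componentE uU.1 (NP _ Nn)).
Qed.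

(** The component of [x N] contains the tail from [N] on, so it is unbounded. Any other unbounded
    component would contain terms of arbitrarily large index, hence meet that tail. *)
Lemma tail_chained_unbounded_component K x : 0 < K ->
  (forall M : R, exists N, forall n, (N <= n)%N -> M <= mdist (x n) x0) ->
  tail_chained K (range x) x x ->
  forall r, 0 < r ->
    exists! U, unbounded_component x0 alpha K (range x `\` ball x0 r) U.
Proof.
move=> K0 xinf xx r r0; have [N NP] := xx r r0.
pose U := [set p | ak_chained x0 alpha K (range x `\` ball x0 r) (x N) p].
have [TN _] := ak_chained_mem (NP N N (leqnn N) (leqnn N)).
have cU : ak_component x0 alpha K (range x `\` ball x0 r) U by exists (x N).
exists U; split.
  split => // -[s Us]; have [M MP] := xinf s.
  have /notin_ball := MP (maxn N M) (leq_maxr _ _); apply; apply: Us.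
  exact: NP (leqnn N) (leq_maxl _ _).
move=> V [cV uV]; have [|n Nn Vn] := @unbounded_frequently _ _ x0 x V N uV.
  by move=> p /(ak_component_subset cV)[].
exact: ak_component_eq cU cV (NP _ _ (leqnn N) Nn) Vn.
Qed.

Lemma ray_equivP K S x y : 0 < K ->
  quasi_ray x0 alpha K S x -> quasi_ray x0 alpha K S y ->
  ray_equiv x0 alpha K S x y <-> tail_chained K S x y.
Proof.
move=> K0 qx qy; split => xy r r0.
  have [_ _ _ /(_ r r0)[U [uU _]]] := qx.
  have [_ _ _ /(_ r r0)[V [uV _]]] := qy.
  have [W [cW UW VW]] := xy r r0 U V uU uV.
  have [N NP] := quasi_ray_tail K0 r0 qx uU.
  have [M MP] := quasi_ray_tail K0 r0 qy uV.
  exists (maxn N M) => n m; rewrite !geq_max => /andP[Nn _] /andP[_ Mm].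
  by have := VW _ (MP _ Mm); rewrite (ak_componentE cW (UW _ (NP _ Nn))).
move=> U V uU uV; have [N NP] := quasi_ray_tail K0 r0 qx uU.
have [M MP] := quasi_ray_tail K0 r0 qy uV; have [B BP] := xy r r0.
pose n := maxn B (maxn N M).
have [Bn Nn Mn] : [/\ B <= n, N <= n & M <= n]%N.
  by rewrite /n !leq_max !leqnn !orbT.
have sub z : quasi_ray x0 alpha K S z ->
    range z `\` ball x0 r `<=` S `\` ball x0 r.
  by move=> [zS _ _ _] _ [[k _ <-] nb]; split.
exists [set p | ak_chained x0 alpha K (S `\` ball x0 r) (x n) p]; split.
- by exists (x n) => //; have [] := ak_chained_mem (BP _ _ Bn Bn).
- move=> p; rewrite (ak_componentE uU.1 (NP _ Nn)) /=.
  exact: ak_chained_sub (sub _ qx).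
- move=> p; rewrite (ak_componentE uV.1 (MP _ Mn)) /= => yp.
  apply: ak_chained_trans (BP _ _ Bn Bn) _.
  exact: ak_chained_sub (sub _ qy) yp.
Qed.

(** The additive term [K] in closeness absorbs the displacement [D], so a single step joins [x m] to
    [y m]; properness of [y] keeps that step outside the ball. *)
Lemma tail_chained_close K S x y D : D <= K -> 0 < K ->
  (forall n, S (x n)) -> (forall n, S (y n)) ->
  (forall n, mdist (x n) (y n) <= D) ->
  (forall M : R, exists N, forall n, (N <= n)%N -> M <= mdist (y n) x0) ->
  tail_chained K S x x -> tail_chained K S x y.
Proof.
move=> DK K0 xS yS xyD yinf xx r r0; have [N NP] := xx r r0.
have [M MP] := yinf r; exists (maxn N M) => n m.
rewrite !geq_max => /andP[Nn _] /andP[Nm Mm].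
have xnm := NP _ _ Nn Nm; apply: (ak_chained_trans xnm).
have [_ Tm] := ak_chained_mem xnm.
have Ty : (S `\` ball x0 r) (y m) by split=> //; apply/notin_ball; exact: MP.
exists 1%N, (fun j => if j is 0%N then x m else y m); split => //.
- by move=> [|j].
- move=> [|j] //= _; rewrite /ak_close (le_trans (xyD m))// (le_trans DK)//.
  by rewrite lerDr mulr_ge0 ?powR_ge0// ltW.
Qed.

End tails.

(** * Ends at a fixed level and their direct limit *)

Section alpha_ends_theory.
Context {R : realType} {X : metricType R} {x0 : X} {alpha : {nonneg R}}.
Context {S : set X}.
Implicit Types (x y : nat -> X) (e : alpha_ends x0 alpha S).

Lemma ak_endsE (K : {posnum R}) (E : ak_ends x0 alpha S K) x y :
  val E x ->
  val E y <-> quasi_ray x0 alpha K%:num S y /\ tail_chained x0 alpha K%:num S x y.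
Proof.
move=> Ex; have PE := ak_endsP E; have qx := is_ak_end_quasi_ray PE Ex.
rewrite (is_ak_endE PE Ex); split=> -[qy xy]; split => //.
  exact: (ray_equivP (gt0 K) qx qy).1.
exact: (ray_equivP (gt0 K) qx qy).2.
Qed.

Lemma ak_ends_of_ray (K : {posnum R}) x : quasi_ray x0 alpha K%:num S x ->
  exists E : ak_ends x0 alpha S K, val E x.
Proof.
move=> qx.
pose E := ray_class x0 alpha K%:num S x.
have PE : is_ak_end x0 alpha K%:num S E by exists x.
exists (exist _ E (mem_set PE) : ak_ends x0 alpha S K) => /=.
by split => //; exact: ray_equiv_refl.
Qed.

Lemma represents_alpha_end_ray e x : represents_alpha_end x e ->
  exists K : {posnum R}, quasi_ray x0 alpha K%:num S x.
Proof.
by move=> [K [E [Ex _]]]; exists K; exact: is_ak_end_quasi_ray (ak_endsP E) Ex.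
Qed.

Lemma represents_alpha_end_of_ray (K : {posnum R}) x :
  quasi_ray x0 alpha K%:num S x ->
  exists e : alpha_ends x0 alpha S, represents_alpha_end x e.
Proof. by move=> /ak_ends_of_ray[E Ex]; eexists; exists K, E. Qed.

Lemma represents_alpha_end_exists e : exists x, represents_alpha_end x e.
Proof.
case: (repr e) (reprK e) => K E eE.
have [x Ex] := is_ak_end_nonempty (gt0 K) (ak_endsP E).
by exists x, K, E.
Qed.

(** At a level above all three constants, the end containing [E] also contains [y], and therefore
    coincides with the end containing [F]. *)
Lemma represents_alpha_end_eq (K : {posnum R}) e e' x y :
  represents_alpha_end x e -> represents_alpha_end y e' ->
  tail_chained x0 alpha K%:num S x y -> e = e'.
Proof.
move=> [L [E [Ex ->]]] [M [F [Fy ->]]] xy.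
have [B [KB LB MB]] : exists B : {posnum R},
    [/\ K%:num <= B%:num, L%:num <= B%:num & M%:num <= B%:num].
  exists (K%:num + L%:num + M%:num)%:pos => /=.
  by have [K0 L0 M0] := And3 (gt0 K) (gt0 L) (gt0 M); split; lra.
have [E' PE' EE'] := is_ak_end_le (gt0 L) LB (ak_endsP E).
have [F' PF' FF'] := is_ak_end_le (gt0 M) MB (ak_endsP F).
pose G : ak_ends x0 alpha S B := exist _ E' (mem_set PE').
have Gx : val G x by exact: EE'.
have Gy : val G y.
  apply/(ak_endsE _ Gx); split; last exact: tail_chained_sub xy.
  exact: is_ak_end_quasi_ray PF' (FF' _ Fy).
apply/eqmodP/asboolP; exists B, G; split => //=.
by rewrite (is_ak_endE PE' Gy) -(is_ak_endE PF' (FF' _ Fy)).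
Qed.

Lemma represents_alpha_end_tail e x y :
  represents_alpha_end x e -> represents_alpha_end y e ->
  exists K : {posnum R}, tail_chained x0 alpha K%:num S x y.
Proof.
move=> [L [E [Ex ->]]] [M [F [Fy /eqmodP/asboolP]]] [B [G [/= _ _ EG FG]]].
by exists B; have [] := (ak_endsE y (EG _ Ex)).1 (FG _ Fy).
Qed.

Lemma represents_alpha_end_unique e e' x :
  represents_alpha_end x e -> represents_alpha_end x e' -> e = e'.
Proof.
move=> xe xe'; have [K] := represents_alpha_end_tail xe xe.
exact: represents_alpha_end_eq.
Qed.

Lemma open_ak_endsP (K : {posnum R}) (A : set (ak_ends x0 alpha S K)) :
  open A <-> forall E, A E -> exists i, [/\ ak_ends_base_index x0 alpha S K i,
    ak_ends_base i E & ak_ends_base i `<=` A].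
Proof.
split.
  move=> [D DI <-] E [i Di iE]; exists i; split => //; first exact: DI.
  by move=> F iF; exists i.
move=> AP.
exists [set i | ak_ends_base_index x0 alpha S K i /\ ak_ends_base i `<=` A].
  by move=> i [].
apply/seteqP; split => [E [i [_ iA] iE]|E /AP[i [Ii iE iA]]]; first exact: iA.
by exists i.
Qed.

(** Membership in a basic open set can be tested on any representative: the tails of two
    representatives are chained outside the ball, so they lie in the same component. *)
Lemma ak_ends_baseP (K : {posnum R}) (E : ak_ends x0 alpha S K) x r U :
  val E x -> ak_ends_base_index x0 alpha S K (r, U) ->
  ak_ends_base (r, U) E <->
  exists N : nat, forall n, (N <= n)%N -> U (x n).
Proof.
move=> Ex [/= r0 [cU _]]; split.
  move=> [y Ey [V uV /= VU]].
  have qy := is_ak_end_quasi_ray (ak_endsP E) Ey.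
  have [M MP] := quasi_ray_tail (gt0 K) r0 qy uV.
  have [_ /(_ r r0)[N NP]] := (ak_endsE x Ey).1 Ex.
  exists (maxn M N) => n; rewrite geq_max => /andP[Mn Nn].
  rewrite (ak_componentE cU (VU _ (MP _ Mn))) /=.
  exact: NP.
move=> [N NP]; have qx := is_ak_end_quasi_ray (ak_endsP E) Ex.
have [xS _ _ /(_ r r0)[V [uV _]]] := qx.
have [M MP] := quasi_ray_tail (gt0 K) r0 qx uV.
exists x => //; exists V => //= p; pose n := maxn M N.
rewrite (ak_componentE uV.1 (MP n (leq_maxl _ _))).
rewrite (ak_componentE cU (NP n (leq_maxr _ _))).
by apply: ak_chained_sub => // _ [[k _ <-] nb]; split.
Qed.

End alpha_ends_theory.

(* The base points need not belong to [S]; hence the last two conditions. *)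
Definition pointed_qi_on (R : realType) (X Y : metricType R) (x0 : X) (y0 : Y)
    (C a : R) (S : set X) (f : X -> Y) : Prop :=
  [/\ 1 <= C, 0 <= a,
    forall p q, S p -> S q -> mdist (f p) (f q) <= C * mdist p q + a /\
      mdist p q <= C * mdist (f p) (f q) + a &
    forall p, S p -> mdist (f p) y0 <= C * mdist p x0 + a /\
      mdist p x0 <= C * mdist (f p) y0 + a].

(** * Transport of closeness, chains, rays and ends *)

Section transport.
Context {R : realType} {X Y : metricType R} {x0 : X} {y0 : Y}.
Context {alpha : {nonneg R}} {S : set X} {T : set Y} {f : X -> Y} {C a : R}.
Hypothesis f_qi : pointed_qi_on x0 y0 C a S f.
Hypothesis fST : forall p, S p -> T (f p).

Lemma ak_close_transport K : 0 < K -> exists L : {posnum R},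
  forall p q, S p -> S q -> ak_close x0 alpha K p q ->
    ak_close y0 alpha L%:num (f p) (f q).
Proof.
move=> K0; have [C1 a0 fd fb] := f_qi; have C0 : 0 <= C by lra.
pose M := (C + a) `^ alpha%:num; have M0 : 0 <= M by exact: powR_ge0.
have CK0 : 0 < C * K by rewrite mulr_gt0//; lra.
have CKM0 : 0 <= C * K * M by rewrite mulr_ge0// ltW.
(* With [s], [t] the minima before and after [f], one has [C * (K * s ^ alpha + K) + a] and
   [s ^ alpha <= M * (t ^ alpha + 1)]. Collecting the constant terms gives this value of [L], which
   also dominates the coefficient [C * K * M] of [t ^ alpha]. *)
have L0 : 0 < C * K * M + C * K + a by lra.
exists (PosNum L0) => p q Sp Sq; rewrite /ak_close /=.
set s := Num.min (mdist p x0) _; set t := Num.min (mdist (f p) y0) _ => pq.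
have t0 : 0 <= t by rewrite le_min !mdist_ge0.
have s0 : 0 <= s by rewrite le_min !mdist_ge0.
(* Whichever image point attains [t], its preimage bounds [s]. *)
have st : s <= C * t + a.
  rewrite /t minEle; case: ifP => _.
    by rewrite ge_min (fb _ Sp).2.
  by rewrite ge_min (fb _ Sq).2 orbT.
have sM : s `^ alpha%:num <= M * (t `^ alpha%:num + 1).
  apply: le_trans (powR_affine_le _ _ _ _) => //.
  by apply: ge0_ler_powR; rewrite ?nnegrE// addr_ge0// mulr_ge0.
have [fpq _] := fd _ _ Sp Sq; apply: (le_trans fpq).
have P0 : 0 <= t `^ alpha%:num by exact: powR_ge0.
have h1 : C * mdist p q <= C * (K * s `^ alpha%:num + K) by rewrite ler_wpM2l.
have h2 : C * K * s `^ alpha%:num <= C * K * (M * (t `^ alpha%:num + 1)).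
  by rewrite ler_wpM2l// ltW.
have h3 : 0 <= (C * K + a) * t `^ alpha%:num by rewrite mulr_ge0//; lra.
lra.
Qed.

Section chains.
Variables (K : R) (L : {posnum R}).
Hypothesis KL : forall p q, S p -> S q -> ak_close x0 alpha K p q ->
  ak_close y0 alpha L%:num (f p) (f q).

Lemma ak_chained_image (A : set X) (B : set Y) p q :
  A `<=` S -> (forall u, A u -> B (f u)) ->
  ak_chained x0 alpha K A p q -> ak_chained y0 alpha L%:num B (f p) (f q).
Proof.
move=> AS AB [n [z [n0 <- <- zA zc]]]; exists n, (f \o z); split => //=.
  by move=> i lin; exact/AB/zA.
move=> i ltin; apply: KL; last exact: zc.
  exact/AS/zA/ltnW.
exact/AS/zA.
Qed.

Lemma notin_ball_image r p : S p -> ~ ball x0 (C * r + a) p -> ~ ball y0 r (f p).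
Proof.
have [C1 a0 _ fb] := f_qi => Sp /notin_ball rp; apply/notin_ball.
by have [_ pf] := fb _ Sp; rewrite -(@ler_pM2l _ C); lra.
Qed.

Lemma ak_chained_image_ball r (A : set X) (B : set Y) p q :
  A `<=` S -> (forall u, A u -> B (f u)) ->
  ak_chained x0 alpha K (A `\` ball x0 (C * r + a)) p q ->
  ak_chained y0 alpha L%:num (B `\` ball y0 r) (f p) (f q).
Proof.
move=> AS AB; apply: ak_chained_image => [u [/AS//]|u [Au nb]].
by split; [exact: AB|apply: notin_ball_image => //; exact: AS].
Qed.

Lemma image_radius_gt0 r : 0 < r -> 0 < C * r + a.
Proof.
by have [C1 a0 _ _] := f_qi => r0; rewrite ltr_pwDl// mulr_gt0//; lra.
Qed.

(** Serves twice: with [S] and [T] for equivalence of rays, and with the ranges of a ray and its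
    image, where chains must stay in the ray itself. *)
Lemma tail_chained_image (A : set X) (B : set Y) (x y : nat -> X) :
  A `<=` S -> (forall u, A u -> B (f u)) ->
  tail_chained x0 alpha K A x y ->
  tail_chained y0 alpha L%:num B (f \o x) (f \o y).
Proof.
move=> AS AB xy r r0; have [N NP] := xy _ (image_radius_gt0 r0).
by exists N => n m Nn Nm; apply: ak_chained_image_ball AS AB (NP _ _ Nn Nm).
Qed.

Lemma quasi_ray_image (x : nat -> X) : 0 < K ->
  quasi_ray x0 alpha K S x -> quasi_ray y0 alpha L%:num T (f \o x).
Proof.
move=> K0 qx; have [xS xconn xqi _] := qx.
have [C1 a0 fd fb] := f_qi.
have xRS : range x `<=` S by move=> _ [n _ <-].
have imx u : range x u -> range (f \o x) (f u) by move=> [n _ <-]; exists n.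
split.
- by move=> n; exact/fST.
- have chn u v : range (f \o x) u -> range (f \o x) v ->
      ak_chained y0 alpha L%:num (range (f \o x)) u v.
    move=> [n _ <-] [m _ <-]; apply: (@ak_chained_image (range x)) => //.
    by apply: ak_connected_chained.
  exists (range (f \o x)); split.
    exists (f (x 0%N)); first by exists 0%N.
    apply/seteqP; split => u /=; first by move=> ux; apply: chn => //; exists 0%N.
    by move=> h; have [] := ak_chained_mem h.
  move=> _ [u ux ->]; apply/seteqP; split => v /=; first by move=> vx; exact: chn.
  by move=> h; have [] := ak_chained_mem h.
- have [K' [g [K'0 [_ [C' [a' [C'1 a'0 gd _]]]] xE]]] := xqi.
  exists K', (f \o g); split => //; last by move=> n /=; rewrite xE.
  split; first by move=> _ [_ [n _ <-] <-]; exists n => //=; rewrite xE.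
  (* The upper bound composes to the additive error [C * a' + a]. The lower one requires [a' + a] to
     be at most [C] times the chosen constant, which follows from [1 <= C]. *)
  exists (C * C'), (C * a' + a' + a); split.
  + by rewrite mulr_ege1.
  + by rewrite !addr_ge0// mulr_ge0// (le_trans ler01).
  + move=> _ _ [n _ <-] [m _ <-] /=; rewrite -!xE.
    have /andP[+ +] := gd (real_ray alpha K' n) (real_ray alpha K' m)
      ltac:(by exists n) ltac:(by exists m).
    rewrite -!xE; set d := mdist _ _ => dl du.
    have [fu fl] := fd _ _ (xS n) (xS m).
    have C'0 : 0 < C' by lra.
    have CC'0 : 0 < C * C' by rewrite mulr_gt0//; lra.
    apply/andP; split; last first.
      have : C * mdist (x n) (x m) <= C * (C' * d + a') by rewrite ler_wpM2l//; lra.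
      lra.
    rewrite lerBlDr ler_pdivrMl//.
    move: dl; rewrite lerBlDr ler_pdivrMl// => dl; apply: (le_trans dl).
    rewrite (mulrC C) -mulrA ler_pM2l//.
    have : 0 <= (C - 1) * a by rewrite mulr_ge0//; lra.
    have : 0 <= (C - 1) * a' by rewrite mulr_ge0//; lra.
    have : 0 <= (C * C) * a' by rewrite !mulr_ge0//; lra.
    lra.
  + move=> _ [n _ <-]; exists (real_ray alpha K' n); first by exists n.
    by rewrite /= xE mdistxx !addr_ge0// mulr_ge0// (le_trans ler01).
- apply: tail_chained_unbounded_component => //.
    move=> M; have [N NP] := quasi_ray_proper qx (C * M + a).
    exists N => n /NP Nn; have [_ pf] := fb _ (xS n).
    by rewrite /= -(@ler_pM2l _ C); lra.
  exact: tail_chained_image xRS imx (quasi_ray_tail_chained K0 qx).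
Qed.

End chains.

Lemma represents_alpha_end_image (x : nat -> X) (e : alpha_ends x0 alpha S) :
  represents_alpha_end x e ->
  exists e' : alpha_ends y0 alpha T, represents_alpha_end (f \o x) e'.
Proof.
move=> /represents_alpha_end_ray[K qx]; have [L KL] := ak_close_transport (gt0 K).
exact: represents_alpha_end_of_ray (quasi_ray_image KL (gt0 K) qx).
Qed.

(** Two representatives of an end are tail-chained for some [K], so their images are tail-chained
    for the transported constant and represent one end. Choosing that end for each [e] gives [h]. *)
Lemma induced_alpha_ends_map :
  exists h : alpha_ends x0 alpha S -> alpha_ends y0 alpha T,
    forall (x : nat -> X) e,
      represents_alpha_end x e -> represents_alpha_end (f \o x) (h e).
Proof.
suff /choice[h hP] : forall e : alpha_ends x0 alpha S,
    exists e' : alpha_ends y0 alpha T, forall x : nat -> X,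
      represents_alpha_end x e -> represents_alpha_end (f \o x) e'.
  by exists h => x e; exact: hP.
move=> e; have [x xe] := represents_alpha_end_exists e.
have [e' xe'] := represents_alpha_end_image xe; exists e' => y ye.
have [e'' ye''] := represents_alpha_end_image ye.
have [K xy] := represents_alpha_end_tail xe ye.
have [L KL] := ak_close_transport (gt0 K).
by rewrite (represents_alpha_end_eq xe' ye'' (tail_chained_image KL _ fST xy)).
Qed.

(** A basic neighbourhood [(r, V)] of the image end contains the image of [(r', W)], where
    [r' = C * r + a] and [W] is the component containing a tail of [x]: chains outside the larger
    ball map to chains outside the smaller one. *)
Lemma induced_alpha_ends_map_continuous
    (h : alpha_ends x0 alpha S -> alpha_ends y0 alpha T) :
  (forall (x : nat -> X) e,
    represents_alpha_end x e -> represents_alpha_end (f \o x) (h e)) ->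
  continuous h.
Proof.
move=> hP; apply/continuousP => U /open_alpha_endsP oU.
apply/open_alpha_endsP => K; have [L KL] := ak_close_transport (gt0 K).
(* One level [L] serves all ends of level [K], so openness in the direct limit need only be used at
   level [L]. *)
have h_end (E : ak_ends x0 alpha S K) x : val E x ->
    exists2 F : ak_ends y0 alpha T L, val F (f \o x) &
      h (\pi_(alpha_ends x0 alpha S) (existT (ak_ends x0 alpha S) K E)) =
      \pi_(alpha_ends y0 alpha T) (existT (ak_ends y0 alpha T) L F).
  move=> Ex; have qx := is_ak_end_quasi_ray (ak_endsP E) Ex.
  have [F Fx] := ak_ends_of_ray (quasi_ray_image KL (gt0 K) qx).
  exists F => //; apply: (@represents_alpha_end_unique _ _ _ _ _ _ _ (f \o x)).
    by apply: hP; exists K, E.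
  by exists L, F.
apply/open_ak_endsP => E /= UE.
have [x Ex] := is_ak_end_nonempty (gt0 K) (ak_endsP E).
have [F Fx hE] := h_end E x Ex; rewrite hE in UE.
have [[r V] [Ir FV VU]] := (open_ak_endsP _).1 (oU L) F UE.
have [/= r0 [cV uV]] := Ir; have [N NP] := (ak_ends_baseP Fx Ir).1 FV.
have qx := is_ak_end_quasi_ray (ak_endsP E) Ex.
have [_ /(_ _ (image_radius_gt0 r0))[M MP]] := (ak_endsE x Ex).1 Ex.
set r' := C * r + a in MP.
pose W := [set p | ak_chained x0 alpha K%:num (S `\` ball x0 r') (x M) p].
have IW : ak_ends_base_index x0 alpha S K (r', W).
  split; first exact: image_radius_gt0.
  split.
    by exists (x M) => //; have [] := ak_chained_mem (MP _ _ (leqnn M) (leqnn M)).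
  move=> [s Ws]; have [B BP] := quasi_ray_proper qx s.
  have /notin_ball := BP (maxn M B) (leq_maxr _ _); apply; apply: Ws.
  exact: MP (leqnn M) (leq_maxl _ _).
exists (r', W); split => //.
  by apply/(ak_ends_baseP Ex IW); exists M => n; exact: MP.
move=> G GW /=; have [y Gy] := is_ak_end_nonempty (gt0 K) (ak_endsP G).
have [F' F'y ->] := h_end G y Gy; apply: VU.
have [B BP] := (ak_ends_baseP Gy IW).1 GW.
apply/(ak_ends_baseP F'y Ir); exists B => n /BP Wyn.
(* The term of index [maxn N M] is the pivot: its image lies in [V], and it is chained through [x M]
   to the tail of [y]. *)
have Vx := NP (maxn N M) (leq_maxl _ _).
rewrite (ak_componentE cV Vx) /=.
apply: (ak_chained_image_ball KL (@subset_refl _ S) fST).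
apply: ak_chained_trans Wyn; apply: ak_chained_sym.
exact: MP (leqnn M) (leq_maxr _ _).
Qed.

End transport.

(** * Mutually inverse induced maps *)

Lemma induced_alpha_ends_map_id (R : realType) (X : metricType R) (x0 : X)
    (alpha : {nonneg R}) (S : set X) (f : X -> X) (D : R)
    (h : alpha_ends x0 alpha S -> alpha_ends x0 alpha S) :
  (forall p, S p -> S (f p) /\ mdist p (f p) <= D) ->
  (forall (x : nat -> X) e,
    represents_alpha_end x e -> represents_alpha_end (f \o x) (h e)) ->
  h =1 id.
Proof.
move=> fD hP e; have [x xe] := represents_alpha_end_exists e.
have fxe := hP _ _ xe; have [K xx] := represents_alpha_end_tail xe xe.
have [M qx] := represents_alpha_end_ray xe; have [xS _ _ _] := qx.
have [M' qfx] := represents_alpha_end_ray fxe.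
(* This constant keeps the chains along [x] and absorbs the displacement; the absolute value makes
   it positive whatever the sign of [D]. *)
have L0 : 0 < K%:num + `|D| by rewrite ltr_pwDl.
apply: esym; apply: (represents_alpha_end_eq (K := PosNum L0) xe fxe).
apply: (@tail_chained_close _ _ x0 alpha (K%:num + `|D|) S _ _ D) => //.
- by rewrite (le_trans (ler_norm D))// lerDr.
- by move=> n; exact: (fD _ (xS n)).1.
- by move=> n; exact: (fD _ (xS n)).2.
- exact: quasi_ray_proper qfx.
- by apply: tail_chained_sub xx => //=; rewrite lerDl.
Qed.

Theorem proposition4p7 (R : realType) (X X' : metricType R) (x0 : X) (x0' : X')
    (alpha : {nonneg R}) (S : set X) (phi : X -> X')
    (phi_qi : quasi_isometry phi) (phi_x0 : phi x0 = x0') :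
  exists h : alpha_ends x0 alpha S -> alpha_ends x0' alpha (phi @` S),
    homeomorphism h /\
    forall (x : nat -> X) (e : alpha_ends x0 alpha S),
      represents_alpha_end x e -> represents_alpha_end (phi \o x) (h e).
Proof.
have [_ [C [a [C1 a0 phid _]]]] := phi_qi.
have C0 : 0 < C by lra.
(* Solving the lower quasi-isometry bound for the source distance turns [a] into [C * a]; this
   larger constant serves both directions. *)
have aCa : a <= C * a by rewrite ler_peMl.
have phiu p q : mdist (phi p) (phi q) <= C * mdist p q + C * a.
  by have /andP[_] := phid p q I I; lra.
have phil p q : mdist p q <= C * mdist (phi p) (phi q) + C * a.
  have /andP[+ _] := phid p q I I.
  by rewrite lerBlDr ler_pdivrMl// mulrDr.
have Ca0 : 0 <= C * a by lra.
have phi_on : pointed_qi_on x0 x0' C (C * a) S phi.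
  by split => // p; rewrite -phi_x0.
(* [psi] is a section of [phi] over the image of [S], with default value [x0] elsewhere. *)
have /choice[psi psiP] : forall y, exists p, (phi @` S) y -> S p /\ phi p = y.
  move=> y; have [[p Sp py]|nSy] := pselect ((phi @` S) y); last by exists x0.
  by exists p.
(* The two-sided bounds are symmetric, so the constants of [phi] carry over. The base point bounds
   come from [phi x0 = x0']; [psi] may move [x0'] away from [x0]. *)
have psi_on : pointed_qi_on x0' x0 C (C * a) (phi @` S) psi.
  split => // [p q /psiP[_ pE] /psiP[_ qE]|p /psiP[_ pE]].
    by rewrite -{2 3}pE -{2 3}qE.
  by rewrite -{2 3}pE -phi_x0.
have phiS p : S p -> (phi @` S) (phi p) by exists p.
have psiS y : (phi @` S) y -> S (psi y) by move=> /psiP[].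
have [h hP] := induced_alpha_ends_map (alpha := alpha) phi_on phiS.
have [g gP] := induced_alpha_ends_map (alpha := alpha) psi_on psiS.
exists h; split => //; exists g; split.
(* [p] and [psi (phi p)] have the same image under [phi], hence are within [C * a]. In the other
   order the composite fixes the image of [S], and the displacement is 0. *)
- apply: (@induced_alpha_ends_map_id _ _ _ _ _ (psi \o phi) (C * a) (g \o h)).
    move=> p Sp; have [Sq qE] := psiP _ (phiS _ Sp); split => //=.
    by have := phil p (psi (phi p)); rewrite qE mdistxx mulr0 add0r.
  by move=> x e /hP/gP.
- apply: (@induced_alpha_ends_map_id _ _ _ _ _ (phi \o psi) 0 (h \o g)).
    move=> y Sy; have [Sq qE] := psiP _ Sy.
    by rewrite /= qE mdistxx.
  by move=> x e /gP/hP.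
- exact: (induced_alpha_ends_map_continuous phi_on phiS hP).
- exact: (induced_alpha_ends_map_continuous psi_on psiS gP).
Qed.
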